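(* For every conjugacy class $C_{\lambda,\mu}$ of $B_n$, \[\mathbb{E}_{\lambda,\mu}[\operatorname{des}_B]=\frac n2-\frac{\Delta^2(\lambda,\mu)}{2n}.\]
   Context: $B_n$ is the group of permutations $\omega$ of $\{\pm1,\dots,\pm n\}$ with $\omega(-i)=-\omega(i)$. $\operatorname{des}_B(\omega)=|\{i\in\{0,\dots,n-1\}:\omega(i)>\omega(i+1)\}|$ with $\omega(0)=0$. A cycle of $\omega$ is a cycle of $|\omega|:i\mapsto|\omega(i)|$; it is even (odd) if the number of its elements $i$ with $\omega(i)<0$ is even (odd). The cycle type is the bi-partition $(\lambda,\mu)$ with $\lambda$ the lengths of even cycles and $\mu$ those of odd cycles; $C_{\lambda,\mu}$ is the conjugacy class of that type and $\mathbb{E}_{\lambda,\mu}$ is expectation under the uniform distribution on it. $\Delta^2(\lambda,\mu)=m_1(\lambda)^2-m_1(\mu)^2$, where $m_1(\cdot)$ is the number of parts equal to $1$. *)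

(* Defs.v *)
From HB Require Import structures.
From mathcomp Require Import all_boot all_order all_fingroup all_algebra.

Set Implicit Arguments.
Unset Strict Implicit.
Unset Printing Implicit Defensive.

Import Order.TTheory GRing.Theory Num.Theory.
Local Open Scope ring_scope.

(* {±1, ..., ±n}: the pair (i, false) stands for i + 1 and (i, true) for
   -(i + 1), since 'I_n is indexed from 0. *)
Definition letter (n : nat) : finType := ('I_n * bool)%type.

Definition pos_letter (n : nat) (i : 'I_n) : letter n := (i, false).

Definition neg_letter (n : nat) (x : letter n) : letter n := (x.1, ~~ x.2).

Definition letter_val (n : nat) (x : letter n) : int :=
  if x.2 then - (x.1.+1)%:Z else (x.1.+1)%:Z.

Lemma letter_val_inj (n : nat) : injective (@letter_val n).
Proof.
case=> i b [j c]; rewrite /letter_val /=.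
by case: b c => [] [] // /eqP; rewrite ?eqr_opp // eqz_nat eqSS => /eqP/val_inj->.
Qed.

Lemma letter_val_neg (n : nat) (x : letter n) :
  letter_val (neg_letter x) = - letter_val x.
Proof. by case: x => i [] //=; rewrite /letter_val /= opprK. Qed.

Definition signed_perms (n : nat) : {set {perm letter n}} :=
  [set w : {perm letter n} | [forall x, w (neg_letter x) == neg_letter (w x)]].

Lemma signed_perms_group_set (n : nat) : group_set (signed_perms n).
Proof.
apply/group_setP; split=> [|u v]; rewrite !inE.
  by apply/forallP => x; rewrite !perm1.
move=> /forallP hu /forallP hv; apply/forallP => x.
by rewrite !permM (eqP (hu x)) (eqP (hv _)).
Qed.

Canonical signed_perms_group (n : nat) : {group {perm letter n}} :=
  Group (signed_perms_group_set n).

(* w(i) as an integer for 0 <= i <= n, with w(0) = 0; the value for i > n is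
   irrelevant. *)
Definition wval (n : nat) (w : {perm letter n}) (i : nat) : int :=
  if i is j.+1 then
    if insub j is Some k then letter_val (w (pos_letter k)) else 0
  else 0.

Definition desB (n : nat) (w : {perm letter n}) : nat :=
  #|[set i : 'I_n | wval w i > wval w i.+1]|.

(* |w|; the default value 1 is never used when w is a signed permutation,
   see abs_permE. *)
Definition abs_perm (n : nat) (w : {perm letter n}) : {perm 'I_n} :=
  insubd (1%g : {perm 'I_n}) [ffun i : 'I_n => (w (pos_letter i)).1].

Lemma abs_permE (n : nat) (w : {perm letter n}) (i : 'I_n) :
  w \in signed_perms n -> abs_perm w i = (w (pos_letter i)).1.
Proof.
rewrite inE => /forallP hw.
have hinj : injectiveb [ffun i : 'I_n => (w (pos_letter i)).1].
  apply/injectiveP => a b; rewrite !ffunE => hab.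
  have [h2|h2] := eqVneq (w (pos_letter a)).2 (w (pos_letter b)).2.
    have : w (pos_letter a) = w (pos_letter b).
      by apply/eqP; rewrite -pair_eqE /= /pair_eq hab h2 !eqxx.
    by move/perm_inj => [].
  have : w (pos_letter a) = w (neg_letter (pos_letter b)).
    rewrite (eqP (hw _)); apply/eqP; rewrite -pair_eqE /= /pair_eq hab eqxx /=.
    by case: (w _).2 (w _).2 h2 => [] [].
  by move/perm_inj.
by rewrite /abs_perm -pvalE val_insubd hinj ffunE.
Qed.

Definition cycle_negs (n : nat) (w : {perm letter n}) (c : {set 'I_n}) : nat :=
  #|[set i in c | letter_val (w (pos_letter i)) < 0]|.

Definition even_cycles (n : nat) (w : {perm letter n}) : {set {set 'I_n}} :=
  [set c in porbits (abs_perm w) | ~~ odd (cycle_negs w c)].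

Definition odd_cycles (n : nat) (w : {perm letter n}) : {set {set 'I_n}} :=
  [set c in porbits (abs_perm w) | odd (cycle_negs w c)].

Definition lengths (n : nat) (P : {set {set 'I_n}}) : seq nat :=
  sort geq [seq #|c| | c : {set 'I_n} <- enum P].

Definition cycle_type (n : nat) (w : {perm letter n}) : seq nat * seq nat :=
  (lengths (even_cycles w), lengths (odd_cycles w)).

(* The cycle type is constant on conjugacy classes, so the type of one element
   determines that of the class. *)
Definition is_class_of_type (n : nat) (la mu : seq nat)
    (C : {set {perm letter n}}) : Prop :=
  C \in classes (signed_perms n) /\
  exists2 w : {perm letter n}, w \in C & cycle_type w = (la, mu).

Definition uniform_mean (T : finType) (C : {set T}) (f : T -> rat) : rat :=
  (\sum_(x in C) f x) / #|C|%:R.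

Definition m1 (la : seq nat) : nat := count_mem 1%N la.

Definition Delta2 (la mu : seq nat) : rat :=
  (m1 la)%:R ^+ 2 - (m1 mu)%:R ^+ 2.

(* Main.v *)
(** Conjugating by the transposition [i <-> i+1] exchanges descents and ascents
    at position [i], except for those [w] that preserve [{i, i+1}] or map it
    onto [{-i, -(i+1)}].  Conjugating by the sign change at [i] makes the two
    transposing exceptional cases cancel, so that only the [w] fixing both
    letters or negating both contribute to the bias; the sign change at the
    first letter treats position 0 in the same way.  The resulting two-point
    counts depend only on whether the two points coincide, and summing them
    over all pairs of points gives the squares in [Delta2]. *)
Require Import Defs.
From HB Require Import structures.
From mathcomp Require Import all_boot all_order all_fingroup all_algebra.
From mathcomp Require Import zify ring lra.

Import Order.TTheory GRing.Theory Num.Theory.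

Local Open Scope ring_scope.

(** * Signed permutations and the conjugators: lifted permutations and sign changes *)

Lemma signed_permsP n (w : {perm letter n}) :
  reflect (forall x, w (neg_letter x) = neg_letter (w x))
          (w \in signed_perms n).
Proof. by rewrite inE; apply: (iffP forallP) => h x; apply/eqP/h. Qed.

(** Covers the identity ([e = false]) and negation ([e = true]) at once, so that fixed and negated
    points share their proofs. *)
Definition twist n (e : bool) (x : letter n) : letter n := (x.1, x.2 (+) e).

Lemma signed_twist n (w : {perm letter n}) e x :
  w \in signed_perms n -> w (twist n e x) = twist n e (w x).
Proof.
move=> /signed_permsP hw; rewrite /twist; case: e.
  by rewrite !addbT; exact: hw.
by rewrite !addbF -!surjective_pairing.
Qed.

Lemma lift_letter_inj n (s : {perm 'I_n}) :
  injective (fun x : letter n => (s x.1, x.2) : letter n).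
Proof. by case=> a b [c d] [] /perm_inj -> ->. Qed.

Definition lift_letter n (s : {perm 'I_n}) : {perm letter n} :=
  perm (lift_letter_inj n s).

Lemma lift_letterE n (s : {perm 'I_n}) a b :
  lift_letter n s (a, b) = (s a, b).
Proof. by rewrite permE. Qed.

Lemma lift_letter_signed n (s : {perm 'I_n}) :
  lift_letter n s \in signed_perms n.
Proof. by apply/signed_permsP => -[a b]; rewrite !lift_letterE. Qed.

Definition flip n (i : 'I_n) : {perm letter n} := tperm (i, false) (i, true).

Lemma flipE n (i a : 'I_n) b : flip n i (a, b) = (a, b (+) (a == i)).
Proof.
rewrite /flip permE /= !xpair_eqE.
by case: b (eqVneq a i) => [] [->|_]; rewrite //= ?addbT ?addbF.
Qed.

Lemma flip_signed n (i : 'I_n) : flip n i \in signed_perms n.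
Proof.
by apply/signed_permsP => -[a b]; rewrite /neg_letter !flipE /= addNb.
Qed.

(** * Fixed and negated points under conjugation *)

Definition fixc n (w : {perm letter n}) (e : bool) (i : 'I_n) : bool :=
  w (pos_letter i) == (i, e).

(** As [w] commutes with negation, either letter over a point serves as a test; a conjugator may
    turn a positive letter into a negative one. *)
Lemma fixc_letter n (w : {perm letter n}) e (x : letter n) :
  w \in signed_perms n -> fixc n w e x.1 = (w x == twist n e x).
Proof.
move=> hw; case: x => a b; rewrite /fixc /=.
have -> : (a, b) = twist n b (pos_letter a) by [].
rewrite signed_twist //; case: (w _) => c d.
by rewrite /twist /= !xpair_eqE; case: b d e => [] [] [].
Qed.

Lemma fixcJ n (w g : {perm letter n}) e (i : 'I_n) :
  w \in signed_perms n -> g \in signed_perms n ->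
  fixc n (w ^ g)%g e (abs_perm g i) = fixc n w e i.
Proof.
move=> hw hg; rewrite abs_permE // fixc_letter ?groupJ // permJ.
by rewrite -signed_twist // (inj_eq perm_inj) -fixc_letter.
Qed.

Lemma abs_perm_lift n (s : {perm 'I_n}) i : abs_perm (lift_letter n s) i = s i.
Proof. by rewrite abs_permE ?lift_letter_signed // lift_letterE. Qed.

Lemma card_fixcJ n (w g : {perm letter n}) e :
  w \in signed_perms n -> g \in signed_perms n ->
  #|[set i | fixc n (w ^ g)%g e i]| = #|[set i | fixc n w e i]|.
Proof.
move=> hw hg.
rewrite -(card_imset [set i | fixc n w e i] (@perm_inj _ (abs_perm g))).
apply: eq_card => i; rewrite -(permKV (abs_perm g) i).
by rewrite mem_imset ?inE ?fixcJ //; apply: perm_inj.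
Qed.

(** * One-element cycles and [m1] *)

Lemma porbit_fix (T : finType) (s : {perm T}) x :
  s x = x -> porbit s x = [set x].
Proof.
move=> sx; apply/setP => y; rewrite inE; apply/porbitP/eqP => [[k ->]|->].
  by rewrite permX iter_fix.
by exists 0%N; rewrite expg0 perm1.
Qed.

Lemma letter_val_lt0 n (x : letter n) : (letter_val x < 0) = x.2.
Proof. by case: x => a [] /=; rewrite /letter_val /=; lia. Qed.

Lemma cycle_negs1 n (w : {perm letter n}) i :
  cycle_negs w [set i] = (w (pos_letter i)).2.
Proof.
rewrite /cycle_negs; case E: (w (pos_letter i)).2.
  rewrite (_ : [set _ | _] = [set i]) ?cards1 //; apply/setP => j.
  by rewrite !inE letter_val_lt0; case: eqVneq => // ->; rewrite E.
rewrite (_ : [set _ | _] = set0) ?cards0 //; apply/setP => j.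
by rewrite !inE letter_val_lt0; case: eqVneq => // ->; rewrite E.
Qed.

Lemma m1_lengths n (P : {set {set 'I_n}}) :
  m1 (lengths P) = #|[set c in P | #|c| == 1%N]|.
Proof.
rewrite /m1; have /seq.permP -> :
    perm_eq (lengths P) [seq #|c| | c : {set 'I_n} <- enum P].
  exact/permEl/perm_sort.
rewrite count_map -size_filter cardE /enum_mem -filter_predI; congr size.
by apply: eq_filter => c; rewrite /= !inE andbC.
Qed.

(** The parity of a cycle [[set i]] is the sign of the image of [i], so the 1-cycles of parity [e]
    are the singletons of the points counted by [fixc]. *)
Lemma card_fixc n (w : {perm letter n}) e : w \in signed_perms n ->
  #|[set c in [set c in porbits (abs_perm w) | odd (cycle_negs w c) == e]
     | #|c| == 1%N]| = #|[set i | fixc n w e i]|.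
Proof.
move=> hw; rewrite -(card_imset [set i | fixc n w e i] (@set1_inj _)).
apply: eq_card => c; rewrite !inE; apply/idP/imsetP.
  case/andP => /andP [hc hodd] /cards1P [i ci]; exists i => //; rewrite inE.
  move: hodd; rewrite ci cycle_negs1 oddb /fixc => /eqP <-.
  have /imsetP [j _ cj] := hc.
  have ij : i = j by apply/esym/set1P; rewrite -ci cj porbit_id.
  have : abs_perm w i \in c.
    by have := mem_porbit (abs_perm w) 1 j; rewrite cj ij expg1.
  rewrite ci abs_permE // => /set1P {2}<-; exact/eqP/surjective_pairing.
case=> i; rewrite inE => /eqP hi ->; rewrite cycle_negs1 oddb hi cards1 !eqxx.
rewrite !andbT; apply/imsetP; exists i => //.
by rewrite porbit_fix // abs_permE // hi.
Qed.

Lemma m1_cycle_type n (w : {perm letter n}) : w \in signed_perms n ->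
  m1 (cycle_type w).1 = #|[set i | fixc n w false i]| /\
  m1 (cycle_type w).2 = #|[set i | fixc n w true i]|.
Proof.
move=> hw; rewrite /= !m1_lengths -!card_fixc //.
by split; apply: eq_card => c; rewrite !inE ?eqbF_neg ?eqb_id.
Qed.

(** * Averaging over a class and comparing a permutation with its conjugate *)

Lemma sum_class {gT : finGroupType} {G : {group gT}} {V : nmodType}
    {C : {set gT}} {f : gT -> V} {g} :
  C \in classes G -> g \in G ->
  \sum_(w in C) f (w ^ g)%g = \sum_(w in C) f w.
Proof.
case/imsetP => x _ -> gG; rewrite [RHS](reindex_inj (conjg_inj g)).
apply: eq_bigl => w; apply/imsetP/imsetP => -[h hG E].
  by exists (h * g)%g; rewrite ?groupM // E conjgM.
by exists (h * g^-1)%g; rewrite ?groupM ?groupV // conjgM -E conjgK.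
Qed.

(** The conjugate sends [i] to the negative of [w(i)], with the sign restored when that letter lies
    over [i]. So the two signs are opposite unless [w] fixes or negates [i], and then they agree. *)
Lemma descent_flip n (w : {perm letter n}) (i : 'I_n) :
  w \in signed_perms n ->
  (w (pos_letter i)).2%:R + ((w ^ flip n i)%g (pos_letter i)).2%:R
  = 1 - (fixc n w false i)%:R + (fixc n w true i)%:R :> rat.
Proof.
move=> hw; have -> : pos_letter i = flip n i (neg_letter (pos_letter i)).
  by rewrite flipE eqxx.
rewrite permJ (signed_permsP _ _ hw) -/(pos_letter _) /fixc.
rewrite (_ : flip n i _ = pos_letter i); last by rewrite flipE eqxx.
case: (w (pos_letter i)) => a b; rewrite /neg_letter /= flipE !xpair_eqE /=.
by case: b (a == i) => [] [] /=; ring.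
Qed.

(** The swap [s] keeps the order of every pair except [i] and [i.+1]. Corrections stand on both
    sides to avoid subtraction in [nat]. *)
Lemma ltn_add_swap (i a c : nat) : a != c ->
  let s x := if x == i then i.+1 else if x == i.+1 then i else x in
  ((c < a)%N + (s a < s c)%N + ((a == i) && (c == i.+1)) =
   1 + ((a == i.+1) && (c == i)))%N.
Proof.
move=> neq /=.
have [ai|ai] := eqVneq a i; have [ai'|ai'] := eqVneq a i.+1;
  have [ci|ci] := eqVneq c i; have [ci'|ci'] := eqVneq c i.+1 => /=;
  try lia.
Qed.

(** Meant for [x = w(i)] and [y = w(j)]: the four corrections are, in order, [w] fixing both
    letters, negating both, swapping them, and swapping them with negation. *)
Lemma lt_letter_swap n (i j : 'I_n) (x y : letter n) :
  j = i.+1 :> nat -> x != y ->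
  let s := lift_letter n (tperm i j) in
  (letter_val y < letter_val x)%R%:R
  + (letter_val (s x) < letter_val (s y))%R%:R
  = 1 - ((x == (i, false)) && (y == (j, false)))%:R
      + ((x == (i, true)) && (y == (j, true)))%:R
      + ((x == (j, false)) && (y == (i, false)))%:R
      - ((x == (j, true)) && (y == (i, true)))%:R :> rat.
Proof.
move=> ij; case: x y => a b [c d]; rewrite !xpair_eqE => neq s.
rewrite /s !lift_letterE /letter_val /= !permE /=.
rewrite -!(inj_eq val_inj) /= !(fun_if val) /= ij in neq *.
(* Opposite signs decide a comparison and [s] keeps signs, so only equal signs remain. *)
case: b d neq => [] []; rewrite ?andbF ?andbT //= => neq.
(* Negation reverses the order, so [a] and [c] exchange roles. *)
- rewrite !ltrN2 !ltz_nat !ltnS; have := ltn_add_swap i c a.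
  rewrite eq_sym => /(_ neq) /(congr1 (fun k => k%:R : rat)).
  rewrite !natrD [(c == i.+1 :> nat) && _]andbC [(c == i :> nat) && _]andbC.
  by move=> /(canRL (addrK _)) ->; ring.
- rewrite !ltz_nat !ltnS.
  have /(congr1 (fun k => k%:R : rat)) := ltn_add_swap i a c neq.
  by rewrite !natrD => /(canRL (addrK _)) ->; ring.
Qed.

(** * Two-point counts over a class *)

Definition fix_bias n (C : {set {perm letter n}}) (i j : 'I_n) : rat :=
  \sum_(w in C) ((fixc n w false i && fixc n w false j)%:R
                - (fixc n w true i && fixc n w true j)%:R).

Section SignedClass.

Variables (n : nat) (C : {set {perm letter n}}).
Hypothesis classC : C \in classes (signed_perms n).

Lemma class_signed w : w \in C -> w \in signed_perms n.
Proof.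
case/imsetP: classC => x xG -> /imsetP [g gG ->].
by rewrite groupJ.
Qed.

Lemma fix_bias_perm (s : {perm 'I_n}) i j :
  fix_bias n C (s i) (s j) = fix_bias n C i j.
Proof.
have sG := lift_letter_signed n s.
rewrite /fix_bias -(sum_class classC sG).
apply: eq_bigr => w /class_signed wG.
by rewrite -(abs_perm_lift n s i) -(abs_perm_lift n s j) !fixcJ.
Qed.

(** The symmetric group is 2-transitive: [s] takes [i] to [i'], then a second transposition takes
    [s j] to [j'] and leaves [i'] alone. *)
Lemma fix_bias_distinct i j i' j' : i != j -> i' != j' ->
  fix_bias n C i j = fix_bias n C i' j'.
Proof.
move=> ij ij'; pose s := tperm i i'.
rewrite -(fix_bias_perm (s * tperm (s j) j')%g) !permM !tpermL.
rewrite tpermD //; last by rewrite eq_sym.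
by rewrite -[X in _ != X](tpermL i i') (inj_eq perm_inj) eq_sym.
Qed.

Lemma sum_fix_bias_row i k :
  \sum_j fix_bias n C i j = \sum_j fix_bias n C k j.
Proof.
rewrite [RHS](reindex_inj (@perm_inj _ (tperm i k))).
by apply: eq_bigr => j _; rewrite -(fix_bias_perm (tperm i k) i j) tpermL.
Qed.

(** For each [w] the double sum of products of indicators is a square of a number of points, and
    that number is constant on [C]. *)
Lemma sum_fix_bias w0 : w0 \in C ->
  \sum_i \sum_j fix_bias n C i j =
  #|C|%:R * ((#|[set i | fixc n w0 false i]|)%:R ^+ 2
             - (#|[set i | fixc n w0 true i]|)%:R ^+ 2).
Proof.
move=> w0C; have w0G := class_signed w0 w0C.
transitivity (\sum_(w in C) \sum_i \sum_j
    ((fixc n w false i && fixc n w false j)%:R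
     - (fixc n w true i && fixc n w true j)%:R : rat)).
  rewrite [RHS]exchange_big /=; apply: eq_bigr => i _; exact: exchange_big.
rewrite mulr_natl -sumr_const; apply: eq_bigr => w wC.
have [g gG ->] : exists2 g, g \in signed_perms n & w = (w0 ^ g)%g.
  case/imsetP: classC wC w0C => x xG -> /imsetP [g gG ->] /imsetP [h hG ->].
  by exists (h^-1 * g)%g; rewrite ?groupM ?groupV // conjgM conjgK.
rewrite -!(card_fixcJ n w0 g) //.
have sq (A : pred 'I_n) :
    \sum_i \sum_j (A i && A j)%:R = #|[set i | A i]|%:R ^+ 2 :> rat.
  rewrite -sum1_card natr_sum [in RHS]big_mkcond expr2 big_distrlr /=.
  apply: eq_bigr => i _; apply: eq_bigr => j _.
  by rewrite !inE; case: (A i) (A j) => [] [] /=; ring.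
rewrite -!sq -sumrB; apply: eq_bigr => i _; exact: sumrB.
Qed.

(** * Descents at a single position *)

Lemma sum_neg i :
  (\sum_(w in C) (w (pos_letter i)).2%:R) *+ 2
  = #|C|%:R - fix_bias n C i i :> rat.
Proof.
rewrite mulr2n -{2}(sum_class classC (flip_signed n i)) -big_split.
rewrite -sumr_const -sumrB; apply: eq_bigr => w /class_signed wG /=.
by rewrite descent_flip // !andbb; ring.
Qed.

Lemma sum_descent (i j : 'I_n) : j = i.+1 :> nat ->
  (\sum_(w in C) (letter_val (w (pos_letter j))
                   < letter_val (w (pos_letter i)))%R%:R) *+ 2
  = #|C|%:R - fix_bias n C i j :> rat.
Proof.
move=> ij; pose s := lift_letter n (tperm i j).
have neq_ij : i != j by rewrite -(inj_eq val_inj) /= ij; lia.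
(* [T b] counts the [w] that swap the two letters ([b = false]) or swap them with negation
   ([b = true]). *)
pose T b := \sum_(w in C)
  ((w (pos_letter i) == (j, b)) && (w (pos_letter j) == (i, b)))%:R : rat.
(* The sign change at [i] conjugates one kind of swap into the other. *)
have TE : T false = T true.
  rewrite /T -(sum_class classC (flip_signed n i)).
  apply: eq_bigr => w /class_signed wG; congr (_ : bool)%:R.
  have fi b : flip n i (i, b) = (i, ~~ b) by rewrite flipE eqxx addbT.
  have fj b : flip n i (j, b) = (j, b).
    by rewrite flipE eq_sym (negbTE neq_ij) addbF.
  have -> : (w ^ flip n i)%g (pos_letter i)
            = flip n i (neg_letter (w (pos_letter i))).
    by rewrite -(signed_permsP _ _ wG) -permJ fi.
  have -> : (w ^ flip n i)%g (pos_letter j) = flip n i (w (pos_letter j)).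
    by rewrite -permJ fj.
  rewrite -[(j, false)]fj -[(i, false)](fi true) !(inj_eq perm_inj).
  by case: (w (pos_letter i)) => a []; rewrite /neg_letter !xpair_eqE.
rewrite mulr2n -{2}(sum_class classC (lift_letter_signed n (tperm i j))).
rewrite -big_split -sumr_const -sumrB /=.
(* Adding [T false] and subtracting the equal [T true] supplies the two swap corrections, so the
   identity can be checked for each [w]. *)
rewrite -[RHS](addrK (T false)) {2}TE /T.
rewrite -big_split -sumrB /=.
apply: eq_bigr => w /class_signed wG.
have sE k : pos_letter (tperm i j k) = s (pos_letter k).
  by rewrite /s lift_letterE.
have -> : (w ^ s)%g (pos_letter j) = s (w (pos_letter i)).
  by rewrite -(tpermL i j) sE permJ.
have -> : (w ^ s)%g (pos_letter i) = s (w (pos_letter j)).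
  by rewrite -(tpermR i j) sE permJ.
rewrite lt_letter_swap //; last by rewrite (inj_eq perm_inj) xpair_eqE andbT.
by rewrite /fixc; ring.
Qed.

End SignedClass.

Theorem theorem4p14 (n : nat) (la mu : seq nat) (C : {set {perm letter n}})
    (hC : is_class_of_type la mu C) :
  uniform_mean C (fun w => (desB w)%:R) =
    n%:R / 2%:R - Delta2 la mu / (2%:R * n%:R).
Proof.
case: hC => classC [w0 w0C [<- <-]].
have [] := m1_cycle_type n w0 (class_signed n C classC w0 w0C).
rewrite /uniform_mean /Delta2 => -> ->.
have := sum_fix_bias n C classC w0 w0C.
case: n C classC w0 w0C => [|m] C classC w0 w0C.
  (* For [n = 0] there are no descents, and the division by zero gives 0. *)
  move=> _; rewrite big1 ?mul0r ?mulr0 ?invr0 ?mulr0 ?subr0 // => w _.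
  by rewrite /desB eq_card0 // => -[].
(* All rows have equal sums, so the double sum is [m.+1] times the row of [ord0]. *)
rewrite (eq_bigr _ (fun i _ => sum_fix_bias_row m.+1 C classC i ord0)).
rewrite sumr_const card_ord big_ord_recl /=.
set D := (X in _ * X) => total.
(* Position 0 is split off: a descent there means that the first letter has a negative image. *)
have desE (w : {perm letter m.+1}) : (desB w)%:R = (w (pos_letter ord0)).2%:R
    + \sum_(j < m) (letter_val (w (pos_letter (lift ord0 j)))
          < letter_val (w (pos_letter (widen_ord (leqnSn m) j))))%R%:R :> rat.
  have wE (k : 'I_m.+1) : wval w k.+1 = letter_val (w (pos_letter k)).
    by rewrite /wval valK.
  rewrite /desB -sum1_card big_mkcond natr_sum big_ord_recl.
  rewrite inE wE letter_val_lt0.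
  congr (_ + _); apply: eq_bigr => j _.
  rewrite inE wE lift0 (wE (widen_ord (leqnSn m) j)).
  by case: (_ < _).
have S2 : (\sum_(w in C) (desB w)%:R) *+ 2 = m.+1%:R * #|C|%:R
    - (fix_bias m.+1 C ord0 ord0
       + \sum_(j < m) fix_bias m.+1 C ord0 (lift ord0 j)).
  rewrite (eq_bigr _ (fun w _ => desE w)) big_split exchange_big /= mulrnDl.
  rewrite sum_neg // -sumrMnl.
  rewrite (eq_bigr (fun j => #|C|%:R - fix_bias m.+1 C ord0 (lift ord0 j))).
    by rewrite sumrB sumr_const card_ord -[_ *+ m]mulr_natl; ring.
  (* The bias of an adjacent pair equals that of the pair [ord0], [lift ord0 j], so the biases add
     up to the row of [ord0]. *)
  move=> j _; rewrite sum_descent //; congr (_ - _).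
  apply: fix_bias_distinct => //.
  by rewrite -(inj_eq val_inj) /= /bump /=; lia.
have C0 : #|C|%:R != 0 :> rat.
  by rewrite pnatr_eq0 -lt0n; apply/card_gt0P; exists w0.
have m0 : m.+1%:R != 0 :> rat by rewrite pnatr_eq0.
move: S2 total; set S := \sum_(w in C) _; set r := fix_bias _ _ _ _ + _.
rewrite -(mulr_natr S) -(mulr_natr r) => S2 total.
have -> : S = (m.+1%:R * #|C|%:R - r) / 2%:R by rewrite -S2; field.
have -> : r = #|C|%:R * D / m.+1%:R by rewrite -total mulfK.
rewrite -/D; move: D => D in total *.
by field; rewrite C0 nat1r m0.
Qed.
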